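(* Let $N\ge 0$ and let $A$ be a $(d+1)\times(d+1)$ complex matrix. The symmetric representation in degree $N$ satisfies $$\overline{A^\top}=B^{-1}\,\bar A^\top\, B,$$ and similarly for adjoints $$\overline{A^*}=B^{-1}\,\bar A^*\,B,$$ where $\bar A^\top=(\bar A)^\top$ and $\bar A^*=(\bar A)^*$.
   Context: Matrices have rows and columns indexed by $0,1,\dots,d$. $A^\top$ is the transpose and $A^*$ the Hermitian (conjugate) transpose. Multi-indices are tuples $n=(n_0,\dots,n_d)$ of nonnegative integers, $|n|=\sum_i n_i$, $x^n=x_0^{n_0}\cdots x_d^{n_d}$. For an integer $N\ge 0$, the symmetric power $\bar A$ of $A$ in degree $N$ is the matrix indexed by multi-indices $m,n$ with $|m|=|n|=N$ defined by $(Ax)^m=\sum_{|n|=N}\bar A_{mn}x^n$, where $(Ax)_i=\sum_j A_{ij}x_j$. The bar always denotes this symmetric power map (never complex conjugation). $B$ is the diagonal matrix indexed by multi-indices of total degree $N$ with $B_{mm}=\binom{N}{m}=\frac{N!}{m_0!\cdots m_d!}$. *)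

(* Defs.v *)
From HB Require Import structures.
From mathcomp Require Import all_boot all_order all_algebra.
From mathcomp Require Import reals complex mpoly.

Set Implicit Arguments.
Unset Strict Implicit.
Unset Printing Implicit Defensive.

Import Order.TTheory GRing.Theory Num.Theory.

#[global] Open Scope ring_scope.
#[global] Open Scope complex_scope.
#[global] Open Scope sesquilinear_scope.

(* The multi-indices n = (n_0, ..., n_d) with |n| = N. Bounding the degree by
   N.+1 in the underlying type is what makes this a finite type. *)
Definition mindex (d N : nat) : finType :=
  {m : 'X_{1..d.+1 < N.+1} | mdeg m == N}.

(* MathComp matrices are indexed by ordinals, so "indexed by multi-indices of
   degree N" means indexed by 'I_#|mindex d N|, where the ordinal i stands for
   the multi-index midx i. *)
Definition midx (d N : nat) (i : 'I_#|mindex d N|) : 'X_{1..d.+1} :=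
  bmnm (val (enum_val i)).

Lemma mdeg_midx d N (i : 'I_#|mindex d N|) : mdeg (midx i) = N.
Proof. exact/eqP/(valP (enum_val i)). Qed.

Lemma midx_inj d N : injective (@midx d N).
Proof. by move=> i j /val_inj/val_inj/enum_val_inj. Qed.

Lemma midx_surj d N (m : 'X_{1..d.+1}) :
  mdeg m = N -> exists i : 'I_#|mindex d N|, midx i = m.
Proof.
move=> mN; have lt_m : (mdeg m < N.+1)%N by rewrite mN.
have Pm : mdeg (BMultinom lt_m) == N by apply/eqP.
by exists (enum_rank (Sub (BMultinom lt_m) Pm : mindex d N)); rewrite /midx enum_rankK.
Qed.

Section SymmetricPower.
Variables (R : comNzRingType) (d : nat).
Implicit Type A : 'M[R]_d.+1.

(* (A x)_i and (A x)^m, as polynomials in the indeterminates x_0, ..., x_d. *)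
Definition linform A (i : 'I_d.+1) : {mpoly R[d.+1]} := \sum_j A i j *: 'X_j.

Definition linmonom A (m : 'X_{1..d.+1}) : {mpoly R[d.+1]} :=
  \prod_k linform A k ^+ m k.

Definition sympow (N : nat) A : 'M[R]_#|mindex d N| :=
  \matrix_(i, j) (linmonom A (midx i))@_(midx j).

Lemma linmonom_homog A (m : 'X_{1..d.+1}) : linmonom A m \is (mdeg m).-homog.
Proof.
rewrite mdegE /linmonom; elim/big_ind2: _ => [|p a q b ph qh|k _].
- exact: dhomog1.
- exact: dhomogM.
rewrite -[X in X.-homog]mul1n; apply: dhomogMn; apply: rpred_sum => j _.
by apply: rpredZ; rewrite dhomogX /= mdeg1.
Qed.

(* (A x)^m = \sum_(|n| = N) \bar A_{mn} x^n characterizes sympow N A. *)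
Lemma sympowP N A (S : 'M[R]_#|mindex d N|) :
  S = sympow N A <->
  forall i, linmonom A (midx i) = \sum_j S i j *: 'X_[midx j].
Proof.
have coefS i k : (\sum_j S i j *: 'X_[midx j])@_(midx k) = S i k.
  rewrite raddf_sum (bigD1 k) //= mcoeffZ mcoeffX eqxx mulr1 big1 ?addr0 // => j jk.
  by rewrite mcoeffZ mcoeffX (inj_eq (@midx_inj d N)) (negPf jk) mulr0.
split=> [defS i|eqS]; last by apply/matrixP=> i k; rewrite mxE eqS coefS.
apply/mpolyP=> m; have [mN|m'N] := eqVneq (mdeg m) N.
  by have [k <-] := midx_surj mN; rewrite coefS defS mxE.
rewrite (dhomog_nemf_coeff (linmonom_homog A (midx i))); last by rewrite mdeg_midx.
rewrite raddf_sum big1 //= => j _; rewrite mcoeffZ mcoeffX.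
by case: eqP => [jm|_]; [rewrite -jm mdeg_midx eqxx in m'N | rewrite mulr0].
Qed.

Lemma sympow_eval N A (x : 'cV[R]_d.+1) (i : 'I_#|mindex d N|) :
  \prod_k (A *m x) k 0 ^+ midx i k =
  \sum_j sympow N A i j * \prod_k x k 0 ^+ midx j k.
Proof.
have /sympowP/(_ i)/(congr1 (meval (fun k => x k 0))) := erefl (sympow N A).
rewrite /linmonom rmorph_prod raddf_sum /= => eqA.
transitivity (\prod_k (linform A k ^+ midx i k).@[fun k => x k 0]).
  apply: eq_bigr => k _; rewrite rmorphXn /= mxE raddf_sum /=; congr (_ ^+ _).
  by apply: eq_bigr => j _; rewrite mevalZ mevalXU.
by rewrite eqA; apply: eq_bigr => j _; rewrite mevalZ mevalX.
Qed.

End SymmetricPower.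

Definition multinomial (F : fieldType) (d N : nat) (m : 'X_{1..d.+1}) : F :=
  N`!%:R / (\prod_k (m k)`!)%:R.

Definition multinomial_mx (F : fieldType) (d N : nat) : 'M[F]_#|mindex d N| :=
  diag_mx (\row_i multinomial F N (midx i)).

(* Hence invmx (multinomial_mx F d N) is a genuine inverse. *)
Lemma multinomial_mx_unit (F : numFieldType) d N :
  multinomial_mx F d N \in unitmx.
Proof.
rewrite unitmxE det_diag unitfE; apply/prodf_neq0 => i _; rewrite mxE.
rewrite mulf_neq0 ?invr_eq0 ?pnatr_eq0 -?lt0n ?fact_gt0 //.
by rewrite prodn_gt0 // => k; apply: fact_gt0.
Qed.

(* Main.v *)
Require Import Defs.
From mathcomp Require Import all_boot all_order all_algebra.
From mathcomp Require Import reals complex mpoly.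

(** Write [m!] for [\prod_k (m k)`!].  As [B_mm = N! / m!], the first identity
    says, entry by entry, that
      [n! * (coefficient of x^n in (A x)^m) =
       m! * (coefficient of x^m in (A^T x)^n)],
    which is [mcoeff_linmonom_tr].  The number [n! * p_n] is the Fischer pairing
    of the polynomial [p] with [x^n], and for this pairing multiplication by
    [x_i] is adjoint to the derivation with respect to [x_i]
    ([mcoeff_fact_MXU], [mcoeff_fact_deriv]).  Raise [n] by one in its entry [j].
    On the left this amounts to differentiating [(A x)^m] with respect to [x_j],
    which gives the sum over [i] of [m_i * A_ij * (A x)^(m - e_i)].  On the right
    it multiplies [(A^T x)^n] by [\sum_i A_ij x_i], and pairing
    [x_i * (A^T x)^n] with [x^m] gives [m_i] times the pairing of [(A^T x)^n]
    with [x^(m - e_i)].  So both sides obey the same recursion, and they agree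
    for [n = 0].  No division occurs, hence this holds over any commutative ring.

    The adjoint is the transpose of the matrix of conjugates, so the second
    identity is the first one for that matrix: [sympow] commutes with the
    entrywise action of a ring morphism ([sympow_map]). *)

Set Implicit Arguments.
Unset Strict Implicit.
Unset Printing Implicit Defensive.

Import GRing.Theory Num.Theory.

Definition mfact n (m : 'X_{1..n}) : nat := \prod_k (m k)`!.

Lemma mfact_gt0 n (m : 'X_{1..n}) : (0 < mfact m)%N.
Proof. by rewrite prodn_gt0 // => k; apply: fact_gt0. Qed.

Lemma mfactDU n (m : 'X_{1..n}) (i : 'I_n) :
  mfact (m + U_(i))%MM = ((m i).+1 * mfact m)%N.
Proof.
rewrite /mfact (bigD1 i) //= [in RHS](bigD1 i) //= mnmDE mnm1E eqxx addn1.
rewrite factS -mulnA; congr (_ * (_ * _))%N.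
by apply: eq_bigr => k /negPf ki; rewrite mnmDE mnm1E eq_sym ki addn0.
Qed.

Lemma submUK n (m : 'X_{1..n}) (i : 'I_n) :
  (0 < m i)%N -> (m - U_(i) + U_(i))%MM = m.
Proof. by move=> mi; rewrite submK // lep1mP -lt0n. Qed.

Lemma mnm_ind n (P : 'X_{1..n} -> Prop) :
  P 0%MM -> (forall m i, P m -> P (m + U_(i))%MM) -> forall m, P m.
Proof.
move=> P0 PS m; have [k] := ubnP (mdeg m); elim: k m => // k IHk m lt_mk.
have [->//|[i mi]] : m = 0%MM \/ exists i, (0 < m i)%N.
  have [/eqP|/existsP[i mi]] := boolP [forall i, m i == 0%N]; last first.
    by right; exists i; rewrite lt0n.
  by move/eqP/forallP=> m0; left; apply/mnmP=> i; rewrite mnm0E; apply/eqP.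
rewrite -(submUK mi); apply/PS/IHk.
by move: lt_mk; rewrite -{1}(submUK mi) mdegD mdeg1 addn1.
Qed.

Section FischerPairing.
Variables (R : comNzRingType) (n : nat).
Implicit Types (p : {mpoly R[n]}) (m : 'X_{1..n}).

(** The case that [mcoeffMX] leaves out, which speaks only of monomials divisible
    by the factor ['X_i]. *)
Lemma mcoeffMXU_eq0 p m i : m i = 0%N -> (p * 'X_i)@_m = 0.
Proof.
move=> mi0; rewrite [p]mpolyE mulr_suml raddf_sum big1 //= => k _.
rewrite -scalerAl -mpolyXD mcoeffZ mcoeffX; case: eqP => [km|_]; last exact: mulr0.
by move: mi0; rewrite -km mnmDE mnm1E eqxx addn1.
Qed.

(** Multiplication by ['X_i] lowers [m] in the Fischer pairing, where the factor
    [m i] is what [mfact] loses.  It also makes the statement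
    hold when [m i = 0], in spite of the truncated difference [m - U_(i)]. *)
Lemma mcoeff_fact_MXU p m i :
  (p * 'X_i)@_m *+ mfact m = p@_(m - U_(i)) *+ mfact (m - U_(i))%MM *+ m i.
Proof.
have [mi0|mi_gt0] := posnP (m i); first by rewrite mcoeffMXU_eq0 // mi0 mul0rn.
rewrite -[in LHS](submUK mi_gt0) [in (_ * _)@__]addmC mcoeffMX mfactDU.
by rewrite mnmBE mnm1E eqxx subn1 prednK // mulnC mulrnA.
Qed.

(** The adjoint rule: a unit added to [m] in its entry [j] can be traded for a
    derivation, because the exponent it brings down is the factor that [mfact]
    gains. *)
Lemma mcoeff_fact_deriv p m j :
  p@_(m + U_(j)) *+ mfact (m + U_(j))%MM = (p^`M(j))@_m *+ mfact m.
Proof. by rewrite mcoeff_deriv mfactDU -mulrnA. Qed.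

End FischerPairing.

Section LinearForms.
Variables (R : comNzRingType) (d : nat).
Implicit Types (A : 'M[R]_d.+1) (m n : 'X_{1..d.+1}).

Lemma linmonomDU A m k : linmonom A (m + U_(k)) = linform A k * linmonom A m.
Proof.
rewrite /linmonom (bigD1 k) //= [in RHS](bigD1 k) //= mnmDE mnm1E eqxx addn1.
rewrite exprS -mulrA; congr (_ * (_ * _)).
by apply: eq_bigr => i /negPf ik; rewrite mnmDE mnm1E eq_sym ik addn0.
Qed.

Lemma linmonom0 A : linmonom A 0 = 1.
Proof. by rewrite /linmonom big1 // => k _; rewrite mnm0E expr0. Qed.

Lemma mderiv_linform A k j : (linform A k)^`M(j) = (A k j)%:MP.
Proof.
rewrite /linform raddf_sum (bigD1 j) //= mderivZ mderivX mnm1E eqxx scale1r.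
rewrite -{1}[U_(j)%MM]add0m addmK mpolyX0 alg_mpolyC big1 ?addr0 // => i /negPf ij.
by rewrite mderivZ mderivX mnm1E ij scale0r scaler0.
Qed.

(** The chain rule for [x^m] composed with [x |-> A x].  When [m i = 0] the
    truncated difference is harmless, as the term has the factor [m i]. *)
Lemma mderiv_linmonom A m j :
  (linmonom A m)^`M(j) = \sum_i A i j *: linmonom A (m - U_(i)) *+ m i.
Proof.
elim/mnm_ind: m => [|m k IHm].
  rewrite linmonom0 big1 => [|i _]; last by rewrite mnm0E mulr0n.
  by rewrite -mpolyC1 mderivC.
rewrite linmonomDU mderivM mderiv_linform IHm mul_mpolyC mulr_sumr.
rewrite (bigD1 k) //= [in RHS](bigD1 k) //= addrA; congr (_ + _); last first.
  apply: eq_bigr => i /negPf ik; rewrite mnmDE mnm1E eq_sym ik addn0.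
  have [->|mi] := posnP (m i); first by rewrite !mulr0n mulr0.
  rewrite mulrnAr -scalerAr -linmonomDU; congr (_ *: linmonom A _ *+ _).
  by rewrite addmC addmBA ?lep1mP -?lt0n // addmC.
rewrite mnmDE mnm1E eqxx addn1 addmK mulrS; congr (_ + _).
have [->|mk] := posnP (m k); first by rewrite !mulr0n mulr0.
by rewrite mulrnAr -scalerAr -linmonomDU submUK.
Qed.

(** Both sides satisfy the same recursion in [n]: the left one by derivation, the
    right one by expanding the linear form that the larger [n] contributes. *)
Lemma mcoeff_linmonom_tr A m n :
  (linmonom A m)@_n *+ mfact n = (linmonom A^T n)@_m *+ mfact m.
Proof.
elim/mnm_ind: n m => [|n j IHn] m.
  (* For n = 0 both sides are 1 or 0 according to whether m = 0: a homogeneous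
     polynomial of positive degree has no constant term. *)
  rewrite linmonom0 mcoeff1.
  have [->|m_neq0] := eqVneq m 0%MM; first by rewrite linmonom0 mcoeff1 eqxx.
  rewrite mul0rn (dhomog_nemf_coeff (linmonom_homog A m)) ?mul0rn //.
  by rewrite /= mdeg0 eq_sym mdeg_eq0.
rewrite mcoeff_fact_deriv mderiv_linmonom linmonomDU /linform mulr_suml.
rewrite !raddf_sum -!sumrMnl /=; apply: eq_bigr => i _.
rewrite mcoeffMn mcoeffZ -scalerAl mcoeffZ mxE mulrnAC -!mulrnAr; congr (_ * _).
by rewrite [_ * linmonom _ _]mulrC mcoeff_fact_MXU IHn.
Qed.

End LinearForms.

Lemma sympow_tr (F : numFieldType) d N (A : 'M[F]_d.+1) :
  sympow N A^T =
    invmx (multinomial_mx F d N) *m (sympow N A)^T *m multinomial_mx F d N.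
Proof.
have unitB := multinomial_mx_unit F d N.
(* Clearing invmx leaves B * sympow N A^T = (sympow N A)^T * B, whose two
   diagonal factors only scale rows and columns. *)
apply: (can_inj (mulKmx unitB)); rewrite -mulmxA mulKVmx //.
apply/matrixP=> i j; rewrite mul_diag_mx mul_mx_diag !mxE /multinomial.
have fact_neq0 k : (mfact (midx k))%:R != 0 :> F.
  by rewrite pnatr_eq0 -lt0n mfact_gt0.
rewrite -!/(mfact _) mulrC [in RHS]mulrCA -[in LHS]mulrCA; congr (_ * _).
apply/eqP; rewrite eqr_div // ; apply/eqP.
by rewrite !mulr_natr mcoeff_linmonom_tr trmxK.
Qed.

Lemma sympow_map (R S : comNzRingType) (f : {rmorphism R -> S}) d N
    (A : 'M[R]_d.+1) :
  sympow N (map_mx f A) = map_mx f (sympow N A).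
Proof.
apply/matrixP=> i j; rewrite !mxE -mcoeff_map_mpoly rmorph_prod.
congr (_@__); apply: eq_bigr => k _; rewrite rmorphXn raddf_sum.
congr (_ ^+ _); apply: eq_bigr => l _.
by rewrite /= map_mpolyZ map_mpolyX mxE.
Qed.

Theorem lemma2p4 (R : realType) (d N : nat) (A : 'M[R[i]]_d.+1) :
  sympow N (A^T) =
    invmx (multinomial_mx R[i] d N) *m (sympow N A)^T *m multinomial_mx R[i] d N
  /\
  sympow N (A ^t*) =
    invmx (multinomial_mx R[i] d N) *m (sympow N A) ^t* *m multinomial_mx R[i] d N.
Proof.
split; first exact: sympow_tr.
by rewrite -map_trmx sympow_tr sympow_map map_trmx.
Qed.
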